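(* Let $n\ge 2$. The monoid homomorphism $VSB_n\to VSG_n$ sending each generator $\sigma_i,\sigma_i^{-1},v_i,\tau_i$ ($1\le i\le n-1$) of $VSB_n$ to the element of $VSG_n$ with the same name (with $\sigma_i^{-1}$ sent to the group inverse of $\sigma_i$) is injective. That is, the virtual singular braid monoid $VSB_n$ embeds in the virtual singular braid group $VSG_n$.
   Context: Let $n\ge 2$. The virtual singular braid monoid $VSB_n$ is the monoid generated by $\sigma_i,\sigma_i^{-1},v_i,\tau_i$ ($1\le i\le n-1$) subject to the relations: $\sigma_i\sigma_i^{-1}=\sigma_i^{-1}\sigma_i=1$; $v_i^2=1$; $\sigma_i\tau_i=\tau_i\sigma_i$; for $|i-j|=1$: $\sigma_i\sigma_j\sigma_i=\sigma_j\sigma_i\sigma_j$, $v_iv_jv_i=v_jv_iv_j$, $v_i\sigma_jv_i=v_j\sigma_iv_j$, $v_i\tau_jv_i=v_j\tau_iv_j$, $\sigma_i\sigma_j\tau_i=\tau_j\sigma_i\sigma_j$; and for $|i-j|>1$: $g_ih_j=h_jg_i$ for all $g_i,h_i\in\{\sigma_i,\tau_i,v_i\}$. The virtual singular braid group $VSG_n$ is the group generated by $\sigma_i,v_i,\tau_i$ ($1\le i\le n-1$) subject to the same relations (regarded as group relations); equivalently, it is obtained from $VSB_n$ by adjoining elements $\bar\tau_i$ with $\tau_i\bar\tau_i=\bar\tau_i\tau_i=1$ and the relations obtained by replacing $\tau_i$ by $\bar\tau_i$ in each relation involving $\tau_i$. We write $\bar\tau_i=\tau_i^{-1}$. *)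

(* Defs.v *)
From mathcomp Require Import all_boot.
Set Implicit Arguments. Unset Strict Implicit. Unset Printing Implicit Defensive.

(* Congruence on words (seq A) generated by a relation R on words:
   the smallest equivalence relation containing R and closed under
   left/right multiplication (concatenation).  The monoid presented by
   <A | R> is seq A modulo [cong R]. *)
Inductive cong (A : Type) (R : seq A -> seq A -> Prop) : seq A -> seq A -> Prop :=
| cong_rel u v l r : R l r -> cong R (u ++ l ++ v) (u ++ r ++ v)
| cong_refl w : cong R w w
| cong_sym w1 w2 : cong R w1 w2 -> cong R w2 w1
| cong_trans w1 w2 w3 : cong R w1 w2 -> cong R w2 w3 -> cong R w1 w3.

(* Indices: generators are indexed by i : 'I_m with m = n - 1, the ordinal
   i standing for the paper's index i+1 (so 1 <= i+1 <= n-1). *)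
Definition adjacent m (i j : 'I_m) : bool := (i.+1 == j :> nat) || (j.+1 == i :> nat).
Definition far m (i j : 'I_m) : bool := (i.+1 < j)%N || (j.+1 < i)%N.

(* The defining relations of VSB_n, expressed over an arbitrary alphabet A in
   which s i, si i, v i, t i interpret sigma_i, sigma_i^{-1}, v_i, tau_i. *)
Inductive vs_rel (m : nat) (A : Type) (s si v t : 'I_m -> A) : seq A -> seq A -> Prop :=
| r_ssi i : vs_rel s si v t [:: s i; si i] [::]
| r_sis i : vs_rel s si v t [:: si i; s i] [::]
| r_vv i : vs_rel s si v t [:: v i; v i] [::]
| r_st i : vs_rel s si v t [:: s i; t i] [:: t i; s i]
| r_sss i j : adjacent i j ->
    vs_rel s si v t [:: s i; s j; s i] [:: s j; s i; s j]
| r_vvv i j : adjacent i j ->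
    vs_rel s si v t [:: v i; v j; v i] [:: v j; v i; v j]
| r_vsv i j : adjacent i j ->
    vs_rel s si v t [:: v i; s j; v i] [:: v j; s i; v j]
| r_vtv i j : adjacent i j ->
    vs_rel s si v t [:: v i; t j; v i] [:: v j; t i; v j]
| r_sst i j : adjacent i j ->
    vs_rel s si v t [:: s i; s j; t i] [:: t j; s i; s j]
| r_far (g h : 'I_m -> A) i j :
    (g = s \/ g = t \/ g = v) -> (h = s \/ h = t \/ h = v) -> far i j ->
    vs_rel s si v t [:: g i; h j] [:: h j; g i].

Inductive mlet (m : nat) : Type :=
| MS of 'I_m | MSi of 'I_m | MV of 'I_m | MT of 'I_m.

(* VSB_n = seq (mlet (n-1)) modulo [cong VSB_rel]. *)
Definition VSB_rel (m : nat) : seq (mlet m) -> seq (mlet m) -> Prop :=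
  vs_rel (@MS m) (@MSi m) (@MV m) (@MT m).

Inductive gkind : Type := KS | KV | KT.
Record glet (m : nat) : Type := GL { gk : gkind; gi : 'I_m; ginv : bool }.

Definition ginverse m (x : glet m) : glet m := GL (gk x) (gi x) (~~ ginv x).

(* Group presentation of VSG_n as a monoid: the same relations (sigma_i^{-1}
   read as the formal inverse of sigma_i) plus x x^{-1} = x^{-1} x = 1 for
   every generator x. *)
Inductive VSG_rel (m : nat) : seq (glet m) -> seq (glet m) -> Prop :=
| g_rel l r : vs_rel (fun i => GL KS i false) (fun i => GL KS i true)
                     (fun i => GL KV i false) (fun i => GL KT i false) l r ->
              VSG_rel l r
| g_inv x : VSG_rel [:: x; ginverse x] [::].

Definition phi m (x : mlet m) : glet m :=
  match x with
  | MS i => GL KS i false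
  | MSi i => GL KS i true
  | MV i => GL KV i false
  | MT i => GL KT i false
  end.

(* Main.v *)
Require Import Defs.
From Stdlib Require Import Setoid Morphisms.
From mathcomp Require Import all_boot all_algebra zify boolp.
Set Implicit Arguments. Unset Strict Implicit. Unset Printing Implicit Defensive.

(** Let [theta] be the homomorphism VSG_n -> VSB_n killing every [tau_i] and
    keeping the other generators; its image consists of units.  A word of VSB_n equals a
    product of conjugates [g tau_i g^-1], with [g] in the image of [theta],
    followed by the word with its [tau]'s deleted.  For two such conjugates [a], [b]
    that do not commute in VSB_n, let VSG_n act on the pairs (unit, point of Z^2)
    so that [tau_i] acts at the unit [g] by one elementary shear if
    [g tau_i g^-1 = a], by the other one if [g tau_i g^-1 = b], and trivially
    otherwise.  Positive words in the two shears are free, so the class in VSG_n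
    determines the subword of [a]'s and [b]'s in the list of conjugates.  As in
    a trace monoid, these projections determine the product of the list. *)

#[local] Hint Resolve cong_refl : core.

(** * Congruences and commutation of words *)

Section Congruence.
Variables (A : Type) (R : seq A -> seq A -> Prop).

#[local] Instance cong_equivalence : Equivalence (cong R).
Proof.
split; [exact: cong_refl | exact: cong_sym | exact: cong_trans].
Qed.

Lemma cong_context u v l r : cong R l r -> cong R (u ++ l ++ v) (u ++ r ++ v).
Proof.
elim=> {l r} [u' v' l r lr | w | w1 w2 _ /cong_sym // | w1 w2 w3 _ IH12 _ ].
- have := cong_rel (u ++ u') (v' ++ v) lr; by rewrite -!catA.
- exact: cong_refl.
- exact: cong_trans.
Qed.

#[local] Instance cong_cat_proper :
  Proper (cong R ==> cong R ==> cong R) (@cat A).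
Proof.
move=> l l' ll' r r' rr'; apply: (@cong_trans _ _ _ (l' ++ r)).
  exact: (@cong_context [::] r).
by have := cong_context l' [::] rr'; rewrite !cats0.
Qed.

Lemma cong_gen l r : R l r -> cong R l r.
Proof. by move=> lr; have := cong_rel [::] [::] lr; rewrite /= !cats0. Qed.

Definition commuting (x y : seq A) := cong R (x ++ y) (y ++ x).

Lemma commutingC x y : commuting x y -> commuting y x.
Proof. exact: cong_sym. Qed.

Lemma commuting_proper x x' y y' :
  cong R x x' -> cong R y y' -> commuting x y -> commuting x' y'.
Proof. by rewrite /commuting => <- <-. Qed.

Lemma commuting_flatten a s :
  (forall b, List.In b s -> commuting b a) -> commuting (flatten s) a.
Proof.
rewrite /commuting; elim: s => [|b s IHs] sa /=; first by rewrite cats0.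
have sba : cong R (b ++ a) (a ++ b) by apply: sa; left.
have ssa : cong R (flatten s ++ a) (a ++ flatten s).
  by apply: IHs => c cs; apply: sa; right.
by rewrite -catA ssa catA sba catA.
Qed.

(** Such a predicate is one congruence class or is empty; the empty case allows projecting onto a
    single class. *)
Definition class_pred (P : pred (seq A)) :=
  (forall x y, cong R x y -> P x = P y) /\ (forall x y, P x -> P y -> cong R x y).

Definition independent_classes (P Q : pred (seq A)) :=
  [/\ class_pred P, class_pred Q & forall x y, P x -> Q y -> ~ commuting x y].

Definition class_of (a : seq A) : pred (seq A) := fun x => `[< cong R a x >].

Lemma class_of_pred a : class_pred (class_of a).
Proof.
split=> x y; first by move=> xy; apply: asbool_equiv_eq; rewrite xy.
by move=> /asboolP ax /asboolP ay; rewrite -ax.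
Qed.

Lemma class_of_refl a : class_of a a.
Proof. by apply/asboolP. Qed.

Lemma independent_class0 a : independent_classes (class_of a) pred0.
Proof. by split=> //; exact: class_of_pred. Qed.

Lemma independent_class2 a b :
  ~ commuting a b -> independent_classes (class_of a) (class_of b).
Proof.
move=> nab; split; [exact: class_of_pred | exact: class_of_pred |].
move=> x y /asboolP ax /asboolP byy xy; apply: nab.
by apply: commuting_proper xy; apply: cong_sym.
Qed.

(** One bit tells [P] from [Q]: independent classes are disjoint, as a word commutes with itself. *)
Definition projection (P Q : pred (seq A)) (s : seq (seq A)) : seq bool :=
  [seq P x | x <- s & P x || Q x].

Lemma projection_cat P Q s1 s2 :
  projection P Q (s1 ++ s2) = projection P Q s1 ++ projection P Q s2.
Proof. by rewrite /projection filter_cat map_cat. Qed.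

Lemma projection_nil P Q s :
  (forall x, List.In x s -> P x || Q x = false) -> projection P Q s = [::].
Proof.
rewrite /projection; elim: s => //= x s IHs Hs.
by rewrite Hs; [apply: IHs => y ys; apply: Hs; right | left].
Qed.

Lemma split_first (T : Type) (P : pred T) s :
  has P s -> exists s1 a s2,
    [/\ s = s1 ++ a :: s2, P a & forall b, List.In b s1 -> P b = false].
Proof.
elim: s => //= x s IHs; case Px: (P x) => /=; first by exists [::], x, s.
move=> /IHs[s1 [a [s2 [-> Pa nP]]]]; exists (x :: s1), a, s2; split=> //.
by move=> b /= [<- | /nP].
Qed.

(** Induction on [s1]: its head [a] recurs in [s2] up to congruence, the first recurrence commutes
    with all that precedes it, so it moves to the front and cancels. *)
Lemma trace_projection (s1 s2 : seq (seq A)) :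
  (forall P Q, independent_classes P Q -> projection P Q s1 = projection P Q s2) ->
  cong R (flatten s1) (flatten s2).
Proof.
elim: s1 s2 => [|a s1 IHs] s2 eqp.
  case: s2 eqp => [|b s2] eqp //.
  have := eqp _ _ (independent_class0 b).
  by rewrite /projection /= class_of_refl.
(* Projecting onto the class of [a] alone counts its occurrences. *)
have : has (class_of a) s2.
  have eqf s : [seq x <- s | class_of a x || pred0 x] = filter (class_of a) s.
    by apply: eq_filter => x; rewrite orbF.
  have := congr1 size (eqp _ _ (independent_class0 a)).
  by rewrite has_count -size_filter /projection !size_map !eqf /= class_of_refl => <-.
move=> /split_first[r1 [a' [r2 [def_s2 aa' na]]]]; subst s2.
(* Otherwise, projected onto the classes of [a] and [b], the first list would start with [true] and
   the second with [false]. *)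
have com b : List.In b r1 -> commuting b a.
  move=> br1; apply: contrapT => nba.
  have nab : ~ commuting a b by move/commutingC.
  have := eqp _ _ (independent_class2 nab).
  suff [t r1t] : exists t, projection (class_of a) (class_of b) r1 = false :: t.
    by rewrite projection_cat r1t /projection /= class_of_refl /= class_of_refl.
  elim: r1 br1 na {eqp} => //= c r1 IHr br1 na.
  rewrite /projection /= (na c) /=; last by left.
  case bc: (class_of b c) => /=; first by eexists; rewrite (na c) //; left.
  apply: IHr => [|d dr1]; last by apply: na; right.
  by case: br1 bc => [-> | //]; rewrite class_of_refl.
move/asboolP: aa' => aa'.
rewrite flatten_cat /= -aa' catA (commuting_flatten com) -catA -flatten_cat.
rewrite -IHs //.
move=> P Q indPQ; have [[invP clP] [invQ clQ] PQ] := indPQ.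
(* A letter of [r1] seen together with [a] would be congruent to [a] or fail to commute with it. *)
have r1_nil : P a || Q a -> projection P Q r1 = [::].
  move=> PQa; apply: projection_nil => b br1; apply/negP.
  have nab : ~ cong R a b by move/asboolP; rewrite -/(class_of a b) na.
  have ba := com b br1; case/orP: PQa => [Pa | Qa] /orP[Pb | Qb].
  - exact: nab (clP _ _ Pa Pb).
  - exact: PQ Pa Qb (commutingC ba).
  - exact: PQ Pb Qa ba.
  - exact: nab (clQ _ _ Qa Qb).
have a'_a : projection P Q [:: a'] = projection P Q [:: a].
  by rewrite /projection /= (invP _ _ aa') (invQ _ _ aa'); case: ifP => //=; rewrite (invP _ _ aa').
have := eqp _ _ indPQ.
rewrite -[a :: s1]cat1s -[a' :: r2]cat1s !projection_cat a'_a.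
case PQa: (P a || Q a).
  by rewrite r1_nil // /projection /= PQa /= => -[->].
by rewrite /projection /= PQa.
Qed.

End Congruence.

#[local] Existing Instance cong_equivalence.
#[local] Existing Instance cong_cat_proper.

(** * Two integer shears generating a free monoid *)

Definition shear (b inv : bool) (z : int * int) : int * int :=
  let: (x, y) := z in
  if b then (if inv then x - y else x + y, y)%R
  else (x, if inv then y - x else y + x)%R.

Lemma shearK b inv : cancel (shear b inv) (shear b (~~ inv)).
Proof. by case=> x y; case: b; case: inv => /=; congr pair; lia. Qed.

(** Positive shears keep both coordinates positive, so comparing them reveals the outermost shear,
    as in the Euclidean algorithm; equality occurs only for the empty word. *)
Lemma shear_word_inj :
  injective (foldr (fun b => shear b false) (1, 1)%R).
Proof.
have pos s : let: (x, y) := foldr (fun b => shear b false) (1, 1)%R s in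
    (0 < x)%R /\ (0 < y)%R.
  by elim: s => //= b s; case: foldr => x y; case: b => /=; lia.
have neq b s : foldr (fun b => shear b false) (1, 1)%R (b :: s) <> (1, 1)%R.
  by have := pos s => /=; case: foldr => x y; case: b => /= H [? ?]; lia.
elim=> [|b s IHs] [|c t] //; [by move/esym/neq | by move/neq |].
have := pos s; have := pos t => /= post poss eqst.
have bc : b = c.
  by case: foldr post poss eqst => x y; case: foldr => x' y';
     case: b; case: c => //= ? ? [? ?]; lia.
by congr cons => //; apply: IHs; apply: (can_inj (shearK c false)); rewrite -{1}bc.
Qed.

(** * The homomorphism [theta] and the conjugates of [tau_i] *)

Section VirtualSingular.
Variable m : nat.
Implicit Types (p q : seq (glet m)) (w : seq (mlet m)) (i j : 'I_m).
Local Notation VSB := (cong (@VSB_rel m)).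
Local Notation VSG := (cong (@VSG_rel m)).

Definition theta_gen (x : glet m) : seq (mlet m) :=
  match x with
  | GL KS i false => [:: MS i]
  | GL KS i true => [:: MSi i]
  | GL KV i _ => [:: MV i]
  | GL KT _ _ => [::]
  end.

Definition theta p : seq (mlet m) := flatten (map theta_gen p).

Lemma theta_cat p q : theta (p ++ q) = theta p ++ theta q.
Proof. by rewrite /theta map_cat flatten_cat. Qed.

Lemma theta_rel p q : VSG_rel p q -> VSB (theta p) (theta q).
Proof.
have vv i : VSB [:: MV i; MV i] [::] by apply: cong_gen; apply: r_vv.
case=> {p q} [l r lr | [k i e]]; last first.
  case: k => //=; [|exact: vv].
  by case: e; apply: cong_gen; constructor.
case: lr => [i|i|i|i|i j ij|i j ij|i j ij|i j ij|i j ij|g h i j].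
all: rewrite /theta /=; try by [apply: cong_refl | apply: cong_gen; constructor].
(* With its [tau] deleted, [r_vtv] reads [v_i^2 = v_j^2]. *)
- by rewrite (vv i) (vv j).
by move=> [|[]] -> [|[]] -> ij //; apply: cong_gen; apply: r_far; auto.
Qed.

Lemma theta_VSG p q : VSG p q -> VSB (theta p) (theta q).
Proof.
elim=> [u v l r lr | w | w1 w2 _ /cong_sym // | w1 w2 w3 _ IH12 _ IH23].
- by rewrite !theta_cat (theta_rel lr).
- by [].
- by rewrite IH12.
Qed.

Definition word_inv p : seq (glet m) := rev (map (@ginverse m) p).

Lemma word_inv_cat p q : word_inv (p ++ q) = word_inv q ++ word_inv p.
Proof. by rewrite /word_inv map_cat rev_cat. Qed.

Lemma ginverseK : involutive (@ginverse m).
Proof. by case=> k i e; rewrite /ginverse /= negbK. Qed.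

Lemma word_invK : involutive word_inv.
Proof.
by move=> p; rewrite /word_inv map_rev revK (mapK ginverseK).
Qed.

Lemma word_invR p : VSG (p ++ word_inv p) [::].
Proof.
elim: p => [|x p IHp] //.
rewrite -cat1s word_inv_cat -catA [p ++ _]catA IHp /=.
by apply: cong_gen; apply: g_inv.
Qed.

Lemma theta_invR p : VSB (theta p ++ theta (word_inv p)) [::].
Proof. by rewrite -theta_cat (theta_VSG (word_invR p)). Qed.

Lemma theta_invL p : VSB (theta (word_inv p) ++ theta p) [::].
Proof. by rewrite -{2}[p]word_invK theta_invR. Qed.

Lemma theta_inv_proper p q :
  VSB (theta p) (theta q) -> VSB (theta (word_inv p)) (theta (word_inv q)).
Proof.
move=> pq; rewrite -[theta (word_inv p)]cats0 -(theta_invR q) catA -pq.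
by rewrite theta_invL.
Qed.

Definition conj_tau p i : seq (mlet m) :=
  theta p ++ [:: MT i] ++ theta (word_inv p).

Lemma conj_tau_proper p q i :
  VSB (theta p) (theta q) -> VSB (conj_tau p i) (conj_tau q i).
Proof. by move=> pq; rewrite /conj_tau pq (theta_inv_proper pq). Qed.

(** Sliding [q] past [tau_i] turns it into [tau_j], after which [q] meets its inverse. *)
Lemma conj_tau_cat p q i j :
  VSB (theta q ++ [:: MT i]) ([:: MT j] ++ theta q) ->
  VSB (conj_tau (p ++ q) i) (conj_tau p j).
Proof.
move=> qij; rewrite /conj_tau word_inv_cat !theta_cat -catA.
rewrite [theta q ++ _]catA qij -!catA [theta q ++ _]catA theta_invR.
exact: cong_refl.
Qed.

Lemma conj_tau_far p i j :
  far i j -> commuting (@VSB_rel m) (conj_tau p i) (conj_tau p j).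
Proof.
have prod k l : VSB (conj_tau p k ++ conj_tau p l)
    (theta p ++ ([:: MT k] ++ [:: MT l]) ++ theta (word_inv p)).
  rewrite /conj_tau -!catA [theta (word_inv p) ++ _]catA theta_invL.
  exact: cong_refl.
move=> ij; rewrite /commuting !prod; apply: cong_context; apply: cong_gen.
by apply: r_far; auto.
Qed.

(** * The action of VSG_n on pairs (unit, lattice point) *)

Section Invariant.
Variables P Q : pred (seq (mlet m)).
Hypothesis indPQ : independent_classes (@VSB_rel m) P Q.

Definition rho (inv : bool) (x : seq (mlet m)) (z : int * int) : int * int :=
  if P x then shear true inv z else if Q x then shear false inv z else z.

Lemma rho_proper inv x y z : VSB x y -> rho inv x z = rho inv y z.
Proof.
have [[invP _] [invQ _] _] := indPQ; move=> xy.
by rewrite /rho (invP _ _ xy) (invQ _ _ xy).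
Qed.

Lemma rhoK inv x : cancel (rho (~~ inv) x) (rho inv x).
Proof.
move=> z; rewrite /rho; case: (P x); [|case: (Q x) => //].
all: by rewrite -{1}[inv]negbK shearK.
Qed.

Lemma rho_commuting x y z : commuting (@VSB_rel m) x y ->
  rho false x (rho false y z) = rho false y (rho false x z).
Proof.
have [_ _ PQ] := indPQ; move=> xy; rewrite /rho.
case Px: (P x); case Py: (P y) => //; case Qy: (Q y) => //; try case Qx: (Q x) => //.
- by case: (PQ x y).
- by case: (PQ x y).
- by case: (PQ y x) => //; apply: commutingC.
- by case: (PQ y x) => //; apply: commutingC.
Qed.

(** The lattice component of the action of [q], started at the unit [theta p]. The last letter acts
    first, each at the unit given by the prefix before it. *)
Fixpoint invariant p q (z : int * int) : int * int :=
  if q is x :: q' then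
    let z' := invariant (rcons p x) q' z in
    if x is GL KT i e then rho e (conj_tau p i) z' else z'
  else z.

Lemma invariant_cat p q1 q2 z :
  invariant p (q1 ++ q2) z = invariant p q1 (invariant (p ++ q1) q2 z).
Proof.
elim: q1 p => [|x q1 IHq] p /=; first by rewrite cats0.
by rewrite IHq cat_rcons.
Qed.

Lemma invariant_proper p p' q z :
  VSB (theta p) (theta p') -> invariant p q z = invariant p' q z.
Proof.
elim: q p p' => //= x q IHq p p' pp'.
rewrite (IHq _ (rcons p' x)); last by rewrite -!cats1 !theta_cat pp'.
by case: x => [[] i e] //; apply: rho_proper; apply: conj_tau_proper.
Qed.

Lemma rho_conj_tau_rcons e p x i z :
  VSB (theta_gen x ++ [:: MT i]) ([:: MT i] ++ theta_gen x) ->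
  rho e (conj_tau (rcons p x) i) z = rho e (conj_tau p i) z.
Proof.
move=> xi; apply: rho_proper; rewrite -cats1; apply: conj_tau_cat.
by rewrite /theta /= cats0.
Qed.

Lemma invariant_rel p q1 q2 z :
  VSG_rel q1 q2 -> invariant p q1 z = invariant p q2 z.
Proof.
case=> {q1 q2} [l r lr | [[] i e] //=]; last first.
  (* As [theta] kills [tau_i], this letter and its inverse act through the same conjugate, with
     opposite signs. *)
  by rewrite rho_conj_tau_rcons // rhoK.
have far_tau (g : 'I_m -> mlet m) i j : g = @MS m \/ g = @MV m -> far i j \/ far j i ->
    VSB ([:: g i] ++ [:: MT j]) ([:: MT j] ++ [:: g i]).
  by move=> gE [] ij; [|apply: cong_sym]; apply: cong_gen; apply: r_far; tauto.
case: lr => //= [i|i j ij|i j ij|g h i j].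
- by rewrite rho_conj_tau_rcons //; apply: cong_gen; apply: r_st.
(* Since [theta] sends the inverse of [v_i] to [v_i], equality of the two conjugates is [r_vtv]
   itself. *)
- apply: rho_proper; rewrite -!cats1 /conj_tau !word_inv_cat !theta_cat -!catA.
  exact: (cong_rel (theta p) (theta (word_inv p))
    (r_vtv (@MS m) (@MSi m) (@MV m) (@MT m) ij)).
- apply: rho_proper; rewrite -!cats1 -catA; apply: conj_tau_cat.
  by apply: cong_gen; apply: r_sst.
move=> [|[]] -> [|[]] -> ij //=; rewrite !rho_conj_tau_rcons //=.
all: try by apply: (far_tau (@MS m)); auto.
all: try by apply: (far_tau (@MV m)); auto.
by apply: rho_commuting; apply: conj_tau_far.
Qed.

Lemma invariant_VSG p q1 q2 z :
  VSG q1 q2 -> invariant p q1 z = invariant p q2 z.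
Proof.
move=> q12; elim: q12 p z => {q1 q2}
  [u v l r lr | // | q1 q2 _ IH | q1 q2 q3 _ IH12 _ IH23] p z.
- rewrite !invariant_cat (invariant_rel _ _ lr).
  (* The letters of [v] act at the same units on both sides, because [theta] respects the
     relation. *)
  congr (invariant _ _ (invariant _ _ _)); apply: invariant_proper.
  by rewrite !theta_cat (theta_rel lr).
- by rewrite IH.
- by rewrite IH12.
Qed.

End Invariant.

(** * Splitting off the conjugates, and the embedding *)

Fixpoint tau_conjugates p w : seq (seq (mlet m)) :=
  if w is x :: w' then
    let c := tau_conjugates (rcons p (phi x)) w' in
    if x is MT i then conj_tau p i :: c else c
  else [::].

(** Each [tau_i] met at a unit [g] is moved left by [g tau_i = (g tau_i g^-1) g]. *)
Lemma tau_conjugates_theta p w :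
  VSB (theta p ++ w)
    (flatten (tau_conjugates p w) ++ theta (p ++ map (@phi m) w)).
Proof.
elim: w p => [|x w IHw] p /=; first by rewrite !cats0.
have theta_x : theta (rcons p (phi x)) = theta p ++ theta [:: phi x].
  by rewrite -cats1 theta_cat.
have := IHw (rcons p (phi x)); rewrite cat_rcons theta_x -catA.
case: x {theta_x} => i //= IH; rewrite -catA -IH /conj_tau -!catA.
by rewrite [theta (word_inv p) ++ _]catA theta_invL.
Qed.

Lemma invariant_projection P Q p w :
  invariant P Q p (map (@phi m) w) (1, 1)%R =
  foldr (fun b => shear b false) (1, 1)%R (projection P Q (tau_conjugates p w)).
Proof.
elim: w p => //= x w IHw p; rewrite IHw; case: x => i //=.
by rewrite /rho /projection /=; case Pc: (P _); case: (Q _); rewrite /= ?Pc.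
Qed.

Lemma VSB_embeds_VSG w1 w2 :
  VSG (map (@phi m) w1) (map (@phi m) w2) -> VSB w1 w2.
Proof.
move=> w12; have := tau_conjugates_theta [::] w1.
have := tau_conjugates_theta [::] w2 => /= -> ->.
(* The [tau]-free factors agree through [theta]; the lists of conjugates are compared by their
   projections. *)
rewrite (theta_VSG w12) (@trace_projection _ _ _ (tau_conjugates [::] w2)) //.
move=> P Q indPQ; apply: shear_word_inj.
by rewrite -!invariant_projection; apply: invariant_VSG.
Qed.

End VirtualSingular.

Theorem mainTheorem1 (n : nat) (hn : (2 <= n)%N) (w1 w2 : seq (mlet n.-1)) :
  cong (@VSG_rel n.-1) (map (@phi n.-1) w1) (map (@phi n.-1) w2) ->
  cong (@VSB_rel n.-1) w1 w2.
Proof.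
exact: VSB_embeds_VSG.
Qed.
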